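(* Let $\mathbf L=(L,\vee,\wedge,0,1)$ be the direct product of a Boolean algebra (regarded as a bounded lattice) and an arbitrary number of lattices $\mathbf M_n$, for possibly various integers $n\ge3$. Let $a,b\in L$ with $a\le b$ and $c\in[a,b]$. Then the following hold: (i) $(c^{ab})^{ab}=\{c\}$; (ii) $\overline c_{ab}=\widehat c_{ab}=c^{ab}$.
   Context: For $n\ge3$, $\mathbf M_n$ is the modular lattice with exactly the $n+2$ elements $0,a_1,\dots,a_n,1$, where $0$ is the least element, $1$ is the greatest element, and $a_1,\dots,a_n$ are pairwise incomparable. Here $[a,b]=\{w\in L\mid a\le w\le b\}$. For $x\in[a,b]$, $x^{ab}:=\{y\in[a,b]\mid x\vee y=b\text{ and }x\wedge y=a\}$; for a subset $A\subseteq[a,b]$, $A^{ab}:=\{y\in[a,b]\mid x\vee y=b\text{ and }x\wedge y=a\text{ for all }x\in A\}$. For $x\in L$, $x^+:=\{y\in L\mid x\vee y=1\text{ and }x\wedge y=0\}$ is the set of complements of $x$ in $\mathbf L$, and $\overline x_{ab}:=(x^+\vee a)\wedge b=\{(y\vee a)\wedge b\mid y\in x^+\}$, $\widehat x_{ab}:=(x^+\wedge b)\vee a=\{(y\wedge b)\vee a\mid y\in x^+\}$. *)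

(* Defs.v *)
From HB Require Import structures.
From mathcomp Require Import all_boot all_order.
From mathcomp Require Import boolp classical_sets.

Set Implicit Arguments.
Unset Strict Implicit.
Unset Printing Implicit Defensive.

Import Order.TTheory.

Local Open Scope classical_set_scope.
Local Open Scope order_scope.

(* The lattice M_n, consisting of a bottom, a top and n atoms a_i. It is built
   for every n; the condition n >= 3 has to be imposed where M_n is used.     *)
Inductive Mn (n : nat) : Type := Mbot | Mtop | Matom of 'I_n.
Arguments Mbot {n}.
Arguments Mtop {n}.

Section MnLattice.
Variable n : nat.
Implicit Types x y z : Mn n.

Definition Mn_encode x : option (option 'I_n) :=
  match x with
  | Mbot => None
  | Mtop => Some None
  | Matom i => Some (Some i)
  end.

Definition Mn_decode (o : option (option 'I_n)) : Mn n :=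
  match o with
  | None => Mbot
  | Some None => Mtop
  | Some (Some i) => Matom i
  end.

Fact Mn_encodeK : cancel Mn_encode Mn_decode. Proof. by case. Qed.

HB.instance Definition _ := Choice.copy (Mn n) (can_type Mn_encodeK).

Definition Mn_le x y : bool :=
  match x, y with
  | Mbot, _ => true
  | _, Mtop => true
  | Matom i, Matom j => i == j
  | _, _ => false
  end.

Definition Mn_meet x y : Mn n :=
  match x, y with
  | Mbot, _ | _, Mbot => Mbot
  | Mtop, z | z, Mtop => z
  | Matom i, Matom j => if i == j then Matom i else Mbot
  end.

Definition Mn_join x y : Mn n :=
  match x, y with
  | Mtop, _ | _, Mtop => Mtop
  | Mbot, z | z, Mbot => z
  | Matom i, Matom j => if i == j then Matom i else Mtop
  end.

Fact Mn_le_refl : reflexive Mn_le. Proof. by case=> //= i; exact: eqxx. Qed.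

Fact Mn_le_anti : antisymmetric Mn_le.
Proof. by case=> [||i] [||j] //= /andP[/eqP ->]. Qed.

Fact Mn_le_trans : transitive Mn_le.
Proof. by case=> [||i] [||j] [||k] //= /eqP ->. Qed.

Fact Mn_display : Order.disp_t. Proof. exact: (Order.Disp tt tt). Qed.

HB.instance Definition _ := Order.Le_isPOrder.Build Mn_display (Mn n)
  Mn_le_refl Mn_le_anti Mn_le_trans.

Fact Mn_meetP x y z : (x <= Mn_meet y z) = (x <= y) && (x <= z).
Proof.
rewrite /Order.le; case: x y z => [||i] [||j] [||k] //=;
  rewrite ?andbT ?andbF //; try by case: eqP.
by case: (eqVneq j k) => [->|/negbTE jk] /=; [rewrite andbb|case: eqP => // ->].
Qed.

Fact Mn_joinP x y z : (Mn_join x y <= z) = (x <= z) && (y <= z).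
Proof.
rewrite /Order.le; case: x y z => [||i] [||j] [||k] //=;
  rewrite ?andbT ?andbF //; try by case: eqP.
case: (eqVneq i j) => [->|/negbTE ij] /=; first by rewrite andbb.
by case: eqP => //= <-; rewrite eq_sym ij.
Qed.

HB.instance Definition _ :=
  Order.POrder_MeetJoin_isLattice.Build Mn_display (Mn n) Mn_meetP Mn_joinP.

Fact Mn_le0x x : Mbot <= x. Proof. by []. Qed.
Fact Mn_lex1 x : x <= Mtop. Proof. by case: x. Qed.

HB.instance Definition _ := Order.hasBottom.Build Mn_display (Mn n) Mn_le0x.
HB.instance Definition _ := Order.hasTop.Build Mn_display (Mn n) Mn_lex1.

End MnLattice.

(* Direct product of an arbitrary, possibly infinite or empty, family of
   bounded lattices, with the componentwise operations.                       *)
Definition dprod (d : Order.disp_t) (I : Type) (T : I -> tbLatticeType d) :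
  Type := forall i, T i.

Fact dprod_display (d : Order.disp_t) : Order.disp_t.
Proof. exact: (Order.Disp tt tt). Qed.

Section DirectProduct.
Variables (d : Order.disp_t) (I : Type) (T : I -> tbLatticeType d).
Implicit Types f g h : dprod T.

HB.instance Definition _ := Choice.copy (dprod T) (forall i, T i).

Definition dprod_le f g : bool := `[< forall i, f i <= g i >].
Definition dprod_meet f g : dprod T := fun i => f i `&` g i.
Definition dprod_join f g : dprod T := fun i => f i `|` g i.
Definition dprod_bot : dprod T := fun=> \bot.
Definition dprod_top : dprod T := fun=> \top.

Fact dprod_le_refl : reflexive dprod_le.
Proof. by move=> f; apply/asboolP. Qed.

Fact dprod_le_anti : antisymmetric dprod_le.
Proof.
move=> f g /andP[/asboolP fg /asboolP gf]; apply: functional_extensionality_dep.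
by move=> i; apply/eqP; rewrite eq_le fg gf.
Qed.

Fact dprod_le_trans : transitive dprod_le.
Proof.
move=> g f h /asboolP fg /asboolP gh; apply/asboolP => i.
exact: le_trans (fg i) (gh i).
Qed.

HB.instance Definition _ := Order.Le_isPOrder.Build (dprod_display d) (dprod T)
  dprod_le_refl dprod_le_anti dprod_le_trans.

Fact dprod_meetP f g h : (f <= dprod_meet g h) = (f <= g) && (f <= h).
Proof.
apply/asboolP/andP => [fgh|[/asboolP fg /asboolP fh] i].
  by split; apply/asboolP => i; have := fgh i; rewrite lexI => /andP[].
by rewrite lexI fg fh.
Qed.

Fact dprod_joinP f g h : (dprod_join f g <= h) = (f <= h) && (g <= h).
Proof.
apply/asboolP/andP => [fgh|[/asboolP fh /asboolP gh] i].
  by split; apply/asboolP => i; have := fgh i; rewrite leUx => /andP[].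
by rewrite leUx fh gh.
Qed.

HB.instance Definition _ := Order.POrder_MeetJoin_isLattice.Build
  (dprod_display d) (dprod T) dprod_meetP dprod_joinP.

Fact dprod_le0x f : dprod_bot <= f.
Proof. by apply/asboolP => i; exact: le0x. Qed.

Fact dprod_lex1 f : f <= dprod_top.
Proof. by apply/asboolP => i; exact: lex1. Qed.

HB.instance Definition _ :=
  Order.hasBottom.Build (dprod_display d) (dprod T) dprod_le0x.
HB.instance Definition _ :=
  Order.hasTop.Build (dprod_display d) (dprod T) dprod_lex1.

End DirectProduct.

Section RelativeComplements.
Variables (d : Order.disp_t) (L : tbLatticeType d).
Implicit Types (a b x y : L) (A : set L).

Definition itvcc a b : set L := [set w | a <= w <= b].

(* x^{ab} *)
Definition relcompl a b x : set L :=
  [set y | itvcc a b y /\ (x `|` y = b /\ x `&` y = a)].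

(* A^{ab} *)
Definition relcompl_set a b A : set L :=
  [set y | itvcc a b y /\ forall x, A x -> x `|` y = b /\ x `&` y = a].

(* x^+ *)
Definition compls x : set L :=
  [set y : L | x `|` y = \top /\ x `&` y = \bot].

(* (x^+ \/ a) /\ b *)
Definition overcompl a b x : set L :=
  [set (y `|` a) `&` b | y in compls x].

(* (x^+ /\ b) \/ a *)
Definition hatcompl a b x : set L :=
  [set (y `&` b) `|` a | y in compls x].

End RelativeComplements.

(* Main.v *)
Require Import Defs.
From mathcomp Require Import all_boot all_order.
From mathcomp Require Import boolp classical_sets.

(** The theorem rests on two properties of a bounded lattice that pass to
    arbitrary direct products: modularity, and the property [separating] below,
    by which an element c of an interval [a, b] can be told apart from any other
    element of the interval by a single complement of c in [a, b].

    Part (i) is a reformulation of separation ([relcompl_setK]).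

    Part (ii) holds in every modular lattice with relative complements.  By
    modularity (y \/ a) /\ b = (y /\ b) \/ a, so the two projections of
    a complement y of c onto [a, b] agree, and the two forms of this element
    show that it is a complement of c in [a, b] ([compls_relcompl]).
    Conversely, a complement z of c in [a, b] is extended to a complement of c
    in [0, b], by taking a complement u of a in [0, z]; then u is extended to
    a complement of c in the whole lattice, by taking a complement of b in
    [u, 1].  Projecting the result onto [a, b] gives back z
    ([relcompl_lift]).

    It remains to look at the factors.  A Boolean algebra is separating since
    its relative complements are unique.  In M_n uniqueness fails only for an
    atom as an element of the whole lattice, and there another atom
    separates. *)

Set Implicit Arguments.
Unset Strict Implicit.
Unset Printing Implicit Defensive.

Import Order.TTheory Order.CTheory.

Local Open Scope classical_set_scope.
Local Open Scope order_scope.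

Definition modular (d : Order.disp_t) (L : tbLatticeType d) : Prop :=
  forall a b y : L, a <= b -> (y `|` a) `&` b = (y `&` b) `|` a.

(** The separating [y] may depend on [z]: this is what lets the property be
    verified coordinatewise in a product, by choosing one [y i] for each
    coordinate.  Taking [z := c] shows that relative complements exist. *)
Definition separating (d : Order.disp_t) (L : tbLatticeType d) : Prop :=
  forall a b c z : L, itvcc a b c -> itvcc a b z ->
  exists2 y, relcompl a b c y & (relcompl a b z y -> z = c).

(** * Relative complements in a bounded lattice *)

Section Relcompl.
Variables (d : Order.disp_t) (L : tbLatticeType d).
Implicit Types a b c u v x y z : L.

Lemma mem_relcompl a b x y : x `|` y = b -> x `&` y = a -> relcompl a b x y.
Proof. by move=> <- <-; split=> //; apply/andP; split; rewrite ?leUr ?leIr. Qed.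

Lemma relcomplC a b x y : relcompl a b x y -> relcompl a b y x.
Proof. by case=> _ [xyb xya]; apply: mem_relcompl; rewrite 1?joinC 1?meetC. Qed.

Lemma relcompl_setK a b c : separating L -> itvcc a b c ->
  relcompl_set a b (relcompl a b c) = [set c].
Proof.
move=> sepL c_ab; apply/seteqP; split=> [z [z_ab z_compl] | _ ->] /=.
  have [y cy] := sepL _ _ _ _ c_ab z_ab; apply.
  by have [yzb yza] := z_compl _ cy; apply/relcomplC/mem_relcompl.
by split=> // y /relcomplC[].
Qed.

Lemma overcompl_hatcompl a b c : modular L -> a <= b ->
  overcompl a b c = hatcompl a b c.
Proof.
by move=> modL le_ab; apply/seteqP; split=> _ [y cy <-]; exists y;
   rewrite ?modL.
Qed.

Lemma compls_relcompl a b c y : modular L -> itvcc a b c -> compls c y ->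
  relcompl a b c ((y `&` b) `|` a).
Proof.
move=> modL /andP[ac cb] [cy1 cy0]; apply: mem_relcompl.
  (* modularity, with [c <= b], gives [c \/ (y /\ b) = (c \/ y) /\ b] *)
  by rewrite joinCA (join_l ac) -modL // joinC cy1 meet1x.
rewrite -modL; last exact: le_trans ac cb.
(* modularity, with [a <= c], gives [c /\ (y \/ a) = (c /\ y) \/ a] *)
by rewrite meetCA (meet_l cb) modL // meetC cy0 join0x.
Qed.

Lemma relcompl_lift a b c z : separating L -> itvcc a b c ->
  relcompl a b c z -> exists2 y, compls c y & (y `&` b) `|` a = z.
Proof.
move=> sepL /andP[ac cb] [/andP[az zb] [czb cza]].
have compl_ex p q x : p <= x -> x <= q -> exists y, relcompl p q x y.
  move=> px xq; have x_pq : itvcc p q x by apply/andP.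
  by have [y xy _] := sepL _ _ _ _ x_pq x_pq; exists y.
have [u [/andP[_ uz] [auz au0]]] := compl_ex \bot z a (le0x _) az.
have [v [_ [bv1 bvu]]] := compl_ex u \top b (le_trans uz zb) (lex1 _).
exists v; last by rewrite meetC bvu joinC.
have cub : c `|` u = b by rewrite -(join_l ac) -joinA auz.
have cu0 : c `&` u = \bot by rewrite -(meet_r uz) meetA cza.
have uv : u <= v by rewrite -bvu leIr.
split; first by rewrite -(join_r uv) joinA cub.
by rewrite -(meet_l cb) -meetA bvu.
Qed.

Lemma hatcompl_relcompl a b c : modular L -> separating L -> itvcc a b c ->
  hatcompl a b c = relcompl a b c.
Proof.
move=> modL sepL c_ab; apply/seteqP; split=> [_ [y cy <-] | z].
  exact: compls_relcompl.
by case/(relcompl_lift sepL c_ab)=> y cy <-; exists y.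
Qed.

End Relcompl.

(** * Direct products *)

Section BinaryProduct.
Variables (d d' : Order.disp_t) (L : tbLatticeType d) (L' : tbLatticeType d').

Lemma modular_prod : modular L -> modular L' -> modular (L *p L').
Proof.
move=> modL modL' [a a'] [b b'] [y y'] /andP[/= ab ab'].
by congr pair; [apply: modL | apply: modL'].
Qed.

Lemma separating_prod : separating L -> separating L' -> separating (L *p L').
Proof.
move=> sepL sepL' [a a'] [b b'] [c c'] [z z'].
move=> /andP[/andP[/= ac ac'] /andP[/= cb cb']].
move=> /andP[/andP[/= az az'] /andP[/= zb zb']].
have [||y [_ [cyb cya]] zc] := sepL a b c z; [exact/andP | exact/andP |].
have [||y' [_ [cyb' cya']] zc'] := sepL' a' b' c' z';
  [exact/andP | exact/andP |].
exists (y, y').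
  by apply: mem_relcompl; congr pair.
case=> _ [[zyb zyb'] [zya zya']].
by congr pair; [apply/zc/mem_relcompl | apply/zc'/mem_relcompl].
Qed.

End BinaryProduct.

Section ArbitraryProduct.
Variables (d : Order.disp_t) (I : Type) (T : I -> tbLatticeType d).

Lemma modular_dprod : (forall i, modular (T i)) -> modular (dprod T).
Proof.
move=> modT a b y /asboolP ab; apply: functional_extensionality_dep => i.
exact: modT.
Qed.

Lemma separating_dprod : (forall i, separating (T i)) -> separating (dprod T).
Proof.
move=> sepT a b c z /andP[/asboolP ac /asboolP cb].
move=> /andP[/asboolP az /asboolP zb].
have yP i : {y | relcompl (a i) (b i) (c i) y /\
    (relcompl (a i) (b i) (z i) y -> z i = c i)}.
  apply: cid; have [||y cy zc] := sepT i (a i) (b i) (c i) (z i);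
    [exact/andP | exact/andP | by exists y].
exists (fun i => sval (yP i)).
  by apply: mem_relcompl; apply: functional_extensionality_dep => i;
     have [[_ []]] := svalP (yP i).
case=> _ [zyb zya]; apply: functional_extensionality_dep => i.
have [_ zc] := svalP (yP i); apply/zc/mem_relcompl.
  exact: (congr1 (fun f : dprod T => f i) zyb).
exact: (congr1 (fun f : dprod T => f i) zya).
Qed.

End ArbitraryProduct.

(** * Boolean algebras *)

Section Boolean.
Variables (d : Order.disp_t) (B : ctbDistrLatticeType d).

Lemma modular_bool : modular B.
Proof. by move=> a b y ab; rewrite meetUl (meet_l ab). Qed.

(** Any [y] separates, since complements in an interval of a distributive lattice
    are unique; one is the projection of the Boolean complement of [c]. *)
Lemma separating_bool : separating B.
Proof.
move=> a b c z c_ab _.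
have cy : compls c (~` c) by split; [exact: joinxC | exact: meetxC].
have := compls_relcompl modular_bool c_ab cy.
move: (_ `|` a) => y cy'; exists y => //.
case: cy' => _ [cyb cya] [_ [zyb zya]].
(* [z = z /\ (c \/ y) = (z /\ c) \/ (z /\ y)], and symmetrically for [c], and
   [z /\ y = a = c /\ y] *)
rewrite -[z](joinKI y) -[c](joinKI y) zyb cyb.
by rewrite -{1}cyb -zyb !meetUr zya cya [c `&` z]meetC.
Qed.

End Boolean.

(** * The lattices M_n *)

Section Mn.
Variable n : nat.
Implicit Types x y : Mn n.

Lemma meet_Mn x y : x `&` y = Mn_meet x y. Proof. by []. Qed.
Lemma join_Mn x y : x `|` y = Mn_join x y. Proof. by []. Qed.
Lemma le_Mn x y : (x <= y) = Mn_le x y. Proof. by []. Qed.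

Lemma modular_Mn : modular (Mn n).
Proof.
move=> a b y; rewrite le_Mn !join_Mn !meet_Mn.
case: a b y => [||i] [||j] [||k] //=; rewrite ?eqxx //.
- by case: ifP.
- by case: ifP.
- by move=> ->.
- by move/eqP->; rewrite eqxx.
- by move/eqP->; case: ifP => //= ->.
Qed.

End Mn.

Lemma other_ord (n : nat) (i : 'I_n) : (1 < n)%N -> exists j, j != i.
Proof.
move=> n_gt1.
have [i0|i0] := eqVneq (i : nat) 0%N.
  by exists (Ordinal n_gt1); rewrite -val_eqE /= i0.
by exists (Ordinal (ltnW n_gt1)); rewrite -val_eqE /= eq_sym.
Qed.

(** An endpoint of an interval has the other endpoint as its only complement.
    An atom [c] of the whole lattice has all other atoms as complements; if [z]
    is one of them, then [z] itself separates, and otherwise every one does. *)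
Lemma separating_Mn (n : nat) : (1 < n)%N -> separating (Mn n).
Proof.
move=> n_gt1 a b c z /andP[ac cb] /andP[az zb]; have ab := le_trans ac cb.
have [->|c_neq_a] := eqVneq c a.
  exists b; first by apply: mem_relcompl; [exact: join_r ab | exact: meet_l ab].
  by case=> _ [_]; rewrite meet_l.
have [->|c_neq_b] := eqVneq c b.
  exists a; first by apply: mem_relcompl; [exact: join_l ab | exact: meet_r ab].
  by case=> _ []; rewrite join_l.
(* strictly between [a] and [b] there is only an atom, in the whole lattice *)
case: a b c ac cb ab az zb c_neq_a c_neq_b
  => [||i] [||j] [||k] //; last 3 first.
- by move=> _ /eqP->; rewrite eqxx.
- by move=> /eqP->; rewrite eqxx.
- by move=> /eqP->; rewrite eqxx.
move=> _ _ _ _ _ _ _.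
have atoms i j : i != j -> relcompl Mbot Mtop (Matom i : Mn n) (Matom j).
  by move=> /negbTE ij; apply: mem_relcompl; rewrite ?join_Mn ?meet_Mn /= ij.
have [z_atom|z_atom] := pselect (exists2 l, l != k & z = Matom l).
  case: z_atom => l lk ->.
  exists (Matom l); first by apply: atoms; rewrite eq_sym.
  by case=> _ []; rewrite joinxx.
have [l lk] := other_ord k n_gt1.
exists (Matom l); first by apply: atoms; rewrite eq_sym.
case: z z_atom => [||m] zP [_ []] //.
by have [->|mk] := eqVneq m k => //; case: zP; exists m.
Qed.

Theorem theorem4p3 (d : Order.disp_t) (B : ctbDistrLatticeType d)
    (I : Type) (n : I -> nat) (n_ge3 : forall i : I, (3 <= n i)%N)
    (a b c : B *p dprod (fun i : I => Mn (n i)))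
    (le_ab : a <= b) (c_ab : itvcc a b c) :
  relcompl_set a b (relcompl a b c) = [set c]
  /\ (overcompl a b c = hatcompl a b c /\ hatcompl a b c = relcompl a b c).
Proof.
pose T i : tbLatticeType Mn_display := Mn (n i).
have modL : modular (B *p dprod T).
  apply: modular_prod (@modular_bool _ B) (modular_dprod _) => i.
  exact: modular_Mn.
have sepL : separating (B *p dprod T).
  apply: separating_prod (@separating_bool _ B) (separating_dprod _) => i.
  exact/separating_Mn/ltnW.
split; first exact: relcompl_setK sepL c_ab.
split; first exact: overcompl_hatcompl modL le_ab.
exact: hatcompl_relcompl modL sepL c_ab.
Qed.
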